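(* Let $D$ be a weighted oriented graph comprised of two unbalanced cycles $\mathcal C_m,\mathcal C_n$ (of lengths $m,n$) sharing a path $P$ of length $k\ge1$, labelled as follows: $V(\mathcal C_m)=\{v_1,\dots,v_m\}$, $V(\mathcal C_n)=\{v_1,\dots,v_{k+1},v_{m+1},\dots,v_{m+n-k-1}\}$, $V(P)=\{v_1,\dots,v_{k+1}\}$, $E(\mathcal C_m)=\{e_1,\dots,e_m\}$, $E(\mathcal C_n)=\{e_1,\dots,e_k,e_{m+1},\dots,e_{m+n-k}\}$, $E(P)=\{e_1,\dots,e_k\}$, where $e_i$ joins $v_i,v_{i+1}$ for $1\le i\le m-1$, $e_m$ joins $v_m,v_1$, and $e_{m+1},\dots,e_{m+n-k}$ are the consecutive edges of the path with successive vertices $v_{k+1},v_{m+1},\dots,v_{m+n-k-1},v_1$. Let $\mathcal C$ be the outer cycle, with edge set $(E(\mathcal C_m)\cup E(\mathcal C_n))\setminus E(P)$, and suppose that $\mathcal C$ is unbalanced. Then $I_D$ is generated by the primitive binomial $f_{\mathbf c_m\mathbf p\mathbf c_n}$, where $$\mathbf c_m\mathbf p\mathbf c_n=\frac1d\Big(((-1)^{i+1}s\,r_i)_{i=1}^k,\ ((-1)^{i+m-k+1}p\,r_{k+i})_{i=1}^{m-k},\ ((-1)^{i+m-k}q\,r_{m+i})_{i=1}^{n-k}\Big)\in\mathbb Z^{m+n-k},$$ with $$\begin{aligned} r_i&=M_{k-1}(A(P)[1,k+1|i]),&&1\le i\le k,\\ r_{k+i}&=M_{m-k-1}(A(\mathcal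 C_m\setminus P)[1,m-k+1|i]),&&1\le i\le m-k,\\ r_{m+i}&=M_{n-k-1}(A(\mathcal C_n\setminus P)[1,n-k+1|i]),&&1\le i\le n-k,\end{aligned}$$ $q=\det A(\mathcal C_m)$, $p=\det A(\mathcal C_n)$, $s=\det A(\mathcal C)$, and $d=\gcd\big((|s|r_i)_{i=1}^k,(|p|r_{k+i})_{i=1}^{m-k},(|q|r_{m+i})_{i=1}^{n-k}\big)$.
   Context: $K$ is a field. A weighted oriented graph $D=(V(D),E(D),\mathbf w)$ is a finite graph without loops or parallel edges, each edge being given an orientation ($(x,y)$ denotes an edge from $x$ to $y$), together with a weight function $\mathbf w:V(D)\to\{1,2,\dots\}$. Its incidence matrix $A(D)$ has rows indexed by vertices and columns by edges; the entry in row $x$ and column $e$ is $1$ if $e=(x,y)$ for some $y$, $\mathbf w(x)$ if $e=(y,x)$ for some $y$, and $0$ otherwise. The toric ideal $I_D$ is the kernel of the $K$-algebra homomorphism $K[e: e\in E(D)]\to K[x: x\in V(D)]$ sending $e=(x,y)$ to $x\,y^{\mathbf w(y)}$. Cycles and paths in $D$ are those of the underlying undirected graph, with inherited orientations and weights (so each has its own incidence matrix). An (even) cycle $\mathcal C$ is balanced if $\det A(\mathcal C)=0$; a cycle that is not balanced is unbalanced (odd cycles always have nonzero determinant). ''Sharing a path $P$'' means that the intersection of the two cycles is exactly $P$. Orderings of rows and columns of the incidence matrices: $A(\mathcal C_m)$: rows $v_1,\dots,v_m$; columns $e_1,\dots,e_m$. $A(\mathcal C_n)$: rows $v_1,\dots,v_{k+1},v_{m+1},\dots,v_{m+n-k-1}$;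 columns $e_1,\dots,e_k,e_{m+1},\dots,e_{m+n-k}$. $A(P)$: rows $v_1,\dots,v_{k+1}$; columns $e_1,\dots,e_k$. $\mathcal C_m\setminus P$ is the path with edges $E(\mathcal C_m)\setminus E(P)$; $A(\mathcal C_m\setminus P)$: rows $v_{k+1},v_{k+2},\dots,v_m,v_1$; columns $e_{k+1},\dots,e_m$. $\mathcal C_n\setminus P$ is the path with edges $E(\mathcal C_n)\setminus E(P)$; $A(\mathcal C_n\setminus P)$: rows $v_{k+1},v_{m+1},\dots,v_{m+n-k-1},v_1$; columns $e_{m+1},\dots,e_{m+n-k}$. $A(\mathcal C)$: rows $v_1,v_m,v_{m-1},\dots,v_{k+2},v_{k+1},v_{m+1},\dots,v_{m+n-k-1}$; columns $e_m,e_{m-1},\dots,e_{k+1},e_{m+1},\dots,e_{m+n-k}$. For a matrix $A$, $M_k(A[i_1,\dots|j_1,\dots])$ denotes the $k\times k$ minor (determinant) obtained from $A$ by deleting rows $i_1,\dots$ and columns $j_1,\dots$; a $0\times0$ minor equals $1$. For $\mathbf b\in\mathbb Z^N$ (with $N$ the number of edges), $f_{\mathbf b}=\prod_{b_i>0}e_i^{b_i}-\prod_{b_i<0}e_i^{-b_i}$. A nonzero binomial $\mathbf e^{\mathbf u}-\mathbf e^{\mathbf v}\in I_D$ is primitive if there is no other nonzero binomial $\mathbf e^{\mathbf u'}-\mathbf e^{\mathbf v'}\in I_D$ with $\mathbf e^{\mathbf u'}\mid\mathbf e^{\mathbf u}$ and $\mathbf e^{\mathbf v'}\mid\mathbf e^{\mathbf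 v}$. *)

(* Defs.v *)
From HB Require Import structures.
From mathcomp Require Import all_boot all_order all_algebra.
From mathcomp Require Import mpoly.

Set Implicit Arguments.
Unset Strict Implicit.
Unset Printing Implicit Defensive.

Import Order.TTheory GRing.Theory Num.Theory.
Local Open Scope ring_scope.

(* The edge x is the pair (src x, tgt x), directed from src x to tgt x. *)
Record wograph (nv ne : nat) := WOGraph {
  src : 'I_ne -> 'I_nv;
  tgt : 'I_ne -> 'I_nv;
  wt : 'I_nv -> nat;
  wograph_loopless : forall x, src x != tgt x;
  wograph_simple : injective (fun x => [set src x; tgt x]);
  wograph_wt_gt0 : forall z, (0 < wt z)%N }.

Section Graph.
Variables (nv ne : nat) (D : wograph nv ne).

Definition incidence : 'M[int]_(nv, ne) :=
  \matrix_(z, x) if z == src D x then 1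
                 else if z == tgt D x then (wt D z)%:Z else 0.

Definition joins (x : 'I_ne) (a b : 'I_nv) : bool :=
  [set src D x; tgt D x] == [set a; b].

(* The j-th edge joins the j-th vertex to the next one, cyclically. *)
Definition is_cycle (vs : seq 'I_nv) (es : seq 'I_ne) : bool :=
  [&& (2 < size vs)%N, size es == size vs, uniq vs, uniq es &
      all (fun t => joins t.1 t.2.1 t.2.2) (zip es (zip vs (rot 1 vs)))].

(* For labellings v and e of the vertices and the edges, the incidence matrix
   of a subgraph, with the vertex labels rs as ordered rows and the edge labels
   cs as ordered columns (r = size rs, c = size cs in all uses). *)
Definition subincidence (v : nat -> 'I_nv) (e : nat -> 'I_ne) (r c : nat)
    (rs cs : seq nat) : 'M[int]_(r, c) :=
  mxsub (fun i : 'I_r => v (nth 0%N rs i)) (fun j : 'I_c => e (nth 0%N cs j))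
        incidence.

Definition balanced v e (l : nat) (rs cs : seq nat) : bool :=
  \det (subincidence v e l l rs cs) == 0.

Section Toric.
Variable K : fieldType.

Definition toric_map (g : {mpoly K[ne]}) : {mpoly K[nv]} :=
  g \mPo [tuple 'X_(src D x) * 'X_(tgt D x) ^+ wt D (tgt D x) | x < ne].

Definition toric_ideal : {pred {mpoly K[ne]}} :=
  fun g => toric_map g == 0.

Definition primitive (f : {mpoly K[ne]}) : Prop :=
  exists u u' : 'X_{1..ne},
    [/\ f = 'X_[u] - 'X_[u'], f != 0, f \in toric_ideal &
        forall w w' : 'X_{1..ne},
          'X_[w] - 'X_[w'] != 0 :> {mpoly K[ne]} ->
          'X_[w] - 'X_[w'] \in toric_ideal ->
          (w <= u)%MM -> (w' <= u')%MM -> w = u /\ w' = u'].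

End Toric.
End Graph.

Arguments toric_ideal {nv ne} D K.

Definition generates (K : fieldType) (n : nat) (f : {mpoly K[n]})
    (I : {pred {mpoly K[n]}}) : Prop :=
  forall g, g \in I <-> exists h, g = h * f.

(* f_b, the j-th entry of b being the exponent of the j-th edge of es. *)
Definition edge_binomial (K : fieldType) (ne : nat) (es : seq 'I_ne)
    (b : seq int) : {mpoly K[ne]} :=
  \prod_(t <- zip es b | 0 < t.2) 'X_(t.1) ^+ `|t.2|%N -
  \prod_(t <- zip es b | t.2 < 0) 'X_(t.1) ^+ `|t.2|%N.

(* M_t(A[R|C]): rows and columns to be deleted are numbered from 1, and t is
   the number of rows and of columns that remain. *)
Definition minor (t p q : nat) (A : 'M[int]_(p, q)) (R C : seq nat) : int :=
  let kept := [seq [seq A i j | j : 'I_q <- enum 'I_q & j.+1 \notin C]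
                              | i : 'I_p <- enum 'I_p & i.+1 \notin R] in
  \det (\matrix_(a < t, b < t) (nth [::] kept a)`_b).

(* Labels of the rows (r...) and columns (c...) of A(C_m), A(C_n), A(P),
   A(C_m \ P), A(C_n \ P) and A(C), in order. *)
Section Orders.
Variables m n k : nat.

Definition rCm := iota 1 m.
Definition cCm := iota 1 m.
Definition rCn := iota 1 k.+1 ++ iota m.+1 (n - k - 1).
Definition cCn := iota 1 k ++ iota m.+1 (n - k).
Definition rP := iota 1 k.+1.
Definition cP := iota 1 k.
Definition rCmP := rcons (iota k.+1 (m - k)) 1%N.
Definition cCmP := iota k.+1 (m - k).
Definition rCnP := k.+1 :: rcons (iota m.+1 (n - k - 1)) 1%N.
Definition cCnP := iota m.+1 (n - k).
Definition rC := 1%N :: rev (iota k.+1 (m - k)) ++ iota m.+1 (n - k - 1).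
Definition cC := rev (iota k.+1 (m - k)) ++ iota m.+1 (n - k).

Section Vector.
Variables (nv ne : nat) (D : wograph nv ne).
Variables (v : nat -> 'I_nv) (e : nat -> 'I_ne).

Definition qdet : int := \det (subincidence D v e m m rCm cCm).
Definition pdet : int := \det (subincidence D v e n n rCn cCn).
Definition sdet : int :=
  \det (subincidence D v e (m + n - k.*2) (m + n - k.*2) rC cC).

(* r_i, r_{k+i} and r_{m+i} *)
Definition r_P (i : nat) : int :=
  minor (k - 1) (subincidence D v e k.+1 k rP cP) [:: 1; k.+1]%N [:: i].
Definition r_Cm (i : nat) : int :=
  minor (m - k - 1) (subincidence D v e (m - k).+1 (m - k) rCmP cCmP)
    [:: 1; (m - k).+1]%N [:: i].
Definition r_Cn (i : nat) : int :=
  minor (n - k - 1) (subincidence D v e (n - k).+1 (n - k) rCnP cCnP)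
    [:: 1; (n - k).+1]%N [:: i].

(* d * c_m p c_n *)
Definition cpc_num : seq int :=
     [seq (-1) ^+ (i + 1) * sdet * r_P i | i <- iota 1 k]
  ++ [seq (-1) ^+ (i + (m - k) + 1) * pdet * r_Cm i | i <- iota 1 (m - k)]
  ++ [seq (-1) ^+ (i + (m - k)) * qdet * r_Cn i | i <- iota 1 (n - k)].

Definition cpc_gcd : nat :=
  \big[gcdn/0%N]_(x <-    [seq `|sdet| * r_P i | i <- iota 1 k]
                       ++ [seq `|pdet| * r_Cm i | i <- iota 1 (m - k)]
                       ++ [seq `|qdet| * r_Cn i | i <- iota 1 (n - k)]) `|x|%N.

Definition cpc : seq int := [seq (x %/ cpc_gcd%:Z)%Z | x <- cpc_num].

End Vector.
End Orders.

(* Main.v *)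
(* The incidence matrix A of D has one more column than rows, and its integral
   kernel has rank 1: since C_m is unbalanced, a kernel vector that vanishes on
   the last edge of C_n \ P vanishes. On each of the three paths P, C_m \ P and
   C_n \ P, the alternating minors r_i solve the equations at the inner vertices
   by telescoping, and the weights s, p, q are exactly what makes the three
   contributions cancel at v_1 and v_(k+1): writing det = (diagonal product) -
   (-1)^length (off-diagonal product) for each cycle turns this into a polynomial
   identity in the six path products. Hence c_m p c_n spans ker A over Z, and the
   toric ideal of a rank-one lattice is generated by the binomial of a generator,
   since u - w = t b telescopes e^u - e^w into t multiples of f_b. *)
Require Import Defs.
From HB Require Import structures.
From mathcomp Require Import all_boot all_order all_algebra.
From mathcomp Require Import mpoly zify ring.

Import Order.TTheory GRing.Theory Num.Theory.
Local Open Scope ring_scope.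

(** * Determinants of paths and cycles *)

Definition bidiagonal (a b : nat -> int) (x y : nat) : int :=
  if x == y then a y else if x == y.+1 then b y else 0.

(** Row 0 has at most two nonzero entries, a_0 in the first column and b_(l+1) in the last. Deleting
    row 0 and either of these columns leaves a triangular matrix, with diagonal a_1, ..., a_(l+1) or
    b_0, ..., b_l. *)
Lemma det_cyclic_bidiagonal (l : nat) (a b : nat -> int) :
  \det (\matrix_(i < l.+2, j < l.+2)
          if i == j :> nat then a j
          else if i == (if j == l.+1 :> nat then 0 else j.+1)%N :> nat then b j
          else 0) =
  \prod_(j < l.+2) a j - (-1) ^+ l.+2 * \prod_(j < l.+2) b j.
Proof.
set M := (\matrix_(i, j) _).
rewrite (expand_det_row _ ord0) [LHS]big_ord_recl.
rewrite [X in _ + X = _]big_ord_recr /= big1 => [|j _]; last first.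
  by rewrite mxE /= /bump /= add1n eqSS (ltn_eqF (ltn_ord j)) mul0r.
rewrite add0r /cofactor !mxE /= /bump leq0n !add1n eqxx /=.
have -> : \det (row' ord0 (col' ord0 M)) = \prod_(j < l.+1) a j.+1.
  rewrite det_trig => [|]; first by apply: eq_bigr => j _; rewrite !mxE eqxx.
  apply/is_trig_mxP => /= i j ltij; rewrite !mxE /= /bump !add1n.
  by case: eqP => [?|_]; [lia | case: eqP => // ; case: ifP => *; lia].
have -> : \det (row' ord0 (col' (lift ord0 ord_max) M)) = \prod_(j < l.+1) b j.
  rewrite -det_tr det_trig => [|].
    apply: eq_bigr => j _; rewrite !mxE /= /bump !add1n.
    have -> : (l < j)%N = false by rewrite ltnNge -ltnS ltn_ord.
    by rewrite add0n gtn_eqF // (ltn_eqF (ltn_ord j)) eqxx.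
  apply/is_trig_mxP => /= i j ltij; rewrite !mxE /= /bump !add1n.
  have -> : (l < i)%N = false by rewrite ltnNge -ltnS ltn_ord.
  by rewrite !add0n; case: eqP => [?|_]; [lia | case: eqP => // ; case: ifP => *; lia].
rewrite [X in _ = X - _]big_ord_recl [in X in _ = _ - X]big_ord_recr /=.
rewrite !addn0 add0n expr0 mul1r.
by congr (_ + _); rewrite !exprS; ring.
Qed.

(** Column [c] is supported on the cyclically consecutive rows [f c] and [g c], so the matrix is
    cyclic bidiagonal. Only the order of traversal enters, not the orientation, which lets one lemma
    serve all three cycles. *)
Lemma det_cycle (E : nat -> nat -> int) (f g : nat -> nat) (rs cs : seq nat)
    (l : nat) :
  size cs = l -> (1 < l)%N -> uniq rs ->
  rs = map f cs -> rot 1 rs = map g cs ->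
  (forall r c, r \in rs -> c \in cs -> r != f c -> r != g c -> E r c = 0) ->
  \det (\matrix_(i < l, j < l) E (nth 0%N rs i) (nth 0%N cs j)) =
  \prod_(c <- cs) E (f c) c - (-1) ^+ l * \prod_(c <- cs) E (g c) c.
Proof.
case: l => [|[|l]] // szc _ Urs rsE rotE E0.
have szr : size rs = l.+2 by rewrite rsE size_map.
rewrite !(@big_nth _ _ _ _ 0%N cs) szc !big_mkord.
rewrite -(det_cyclic_bidiagonal l (fun j => E (f (nth 0%N cs j)) (nth 0%N cs j))
  (fun j => E (g (nth 0%N cs j)) (nth 0%N cs j))).
congr (\det _); apply/matrixP => i j; rewrite !mxE.
have fE (h : 'I_l.+2) : f (nth 0%N cs h) = nth 0%N rs h.
  by rewrite rsE (nth_map 0%N) ?szc.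
pose s (h : nat) := (if h == l.+1 then 0 else h.+1)%N.
have s_lt h : (h < l.+2)%N -> (s h < l.+2)%N.
  by rewrite /s; case: eqP => ? ?; lia.
have gE (h : 'I_l.+2) : g (nth 0%N cs h) = nth 0%N rs (s h).
  rewrite -(nth_map 0%N 0%N) ?szc // -rotE /s.
  case: (rs) szr => // x t [szt]; rewrite rot1_cons nth_rcons szt /=.
  by have := ltn_ord h; case: (ltngtP h l.+1) => // *; lia.
case: eqP => [->|/eqP nij]; first by rewrite fE.
rewrite -/(s j); case: eqP => [->|/eqP nis]; first by rewrite gE.
by apply: E0; rewrite ?mem_nth ?szr ?szc ?fE ?gE // nth_uniq ?szr ?s_lt.
Qed.

(** The closed form of the minors r_i of a path with t edges: edges before edge i contribute their
    entry at the end vertex, edges after it their entry at the start vertex. *)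
Definition path_minor (a b : nat -> int) (t i : nat) : int :=
  \prod_(j < i) b j * \prod_(i <= j < t.-1) a j.+1.

(* The matrix is block diagonal: an upper triangular block with diagonal
   b_0, ..., b_(i-1), then a lower triangular one with diagonal
   a_(i+1), ..., a_t. *)
Lemma det_path_minor (t i : nat) (a b : nat -> int) : (i <= t)%N ->
  \det (\matrix_(x < t, y < t) bidiagonal a b x.+1 (bump i y)) =
  path_minor a b t.+1 i.
Proof.
rewrite /path_minor /=; elim: t => [|t IHt] in i a b *.
  by case: i => // _; rewrite det_mx00 big_ord0 big_geq ?mulr1.
case: i => [_|i leit].
  rewrite big_ord0 mul1r big_mkord det_trig => [|].
    by apply: eq_bigr => j _; rewrite mxE /bidiagonal /bump leq0n add1n eqxx.
  apply/is_trig_mxP => /= x y ltxy; rewrite mxE /bidiagonal /bump leq0n add1n.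
  by case: eqP => [?|_]; [lia | case: eqP => *; lia].
rewrite (expand_det_col _ ord0) big_ord_recl big1 => [|x _]; last first.
  by rewrite mxE /bidiagonal /= /bump /= mul0r.
rewrite addr0 mxE /bidiagonal /bump /= /cofactor /= expr0 mul1r.
have -> : row' ord0 (col' ord0 (\matrix_(x < t.+1, y < t.+1)
     bidiagonal a b x.+1 (bump i.+1 y))) =
     \matrix_(x < t, y < t) bidiagonal (a \o S) (b \o S) x.+1 (bump i y).
  apply/matrixP => x y; rewrite !mxE /bidiagonal /bump /=.
  by rewrite /bump !add1n ltnS addnS !eqSS.
by rewrite -/(bidiagonal _ _) IHt // big_ord_recl big_add1 mulrA.
Qed.

(** * Minors as determinants over explicit index ranges *)

Lemma nth_filter_enum (n i : nat) (P : pred nat) (h : 'I_n) :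
  (i < size [seq x <- iota 0 n | P x])%N ->
  nth h [seq x : 'I_n <- enum 'I_n | P x] i =
  nth 0%N [seq x <- iota 0 n | P x] i :> nat.
Proof.
rewrite -val_enum_ord filter_map size_map => lti.
by rewrite (nth_map h).
Qed.

Lemma filter_iota_ends (t : nat) : (0 < t)%N ->
  [seq x <- iota 0 t.+1 | x.+1 \notin [:: 1; t.+1]%N] = iota 1 t.-1.
Proof.
case: t => // t _; rewrite -[in iota _ _]addn1 iotaD filter_cat /= inE mem_seq1.
rewrite add0n eqxx orbT cats0.
by apply/all_filterP/allP => x; rewrite mem_iota !inE; lia.
Qed.

Lemma filter_iota_neq (t i : nat) : (i < t)%N ->
  [seq x <- iota 0 t | x.+1 \notin [:: i.+1]] =
  [seq bump i x | x <- iota 0 t.-1].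
Proof.
move=> ltit; have [s ->] : exists s, t = (i + s.+1)%N by exists (t.-1 - i)%N; lia.
rewrite addnS iotaD -addnS iotaD filter_cat map_cat /= !inE eqxx /=.
congr (_ ++ _).
  have -> : [seq bump i x | x <- iota 0 i] = iota 0 i.
    by apply: map_id_in => x; rewrite mem_iota /bump => ?; lia.
  by apply/all_filterP/allP => x; rewrite mem_iota !inE; lia.
rewrite (all_filterP _); last by apply/allP => x; rewrite mem_iota !inE; lia.
rewrite -add1n iotaDl; apply/eq_in_map => x; rewrite mem_iota /bump => ?; lia.
Qed.

(** Leaves the list encoding of [minor]: dropping the end rows shifts row indices by one, and
    dropping the column numbered i + 1 from 1 skips index i, which is what [bump i] does. *)
Lemma minor_ends (t i : nat) (F : nat -> nat -> int) (A : 'M[int]_(t.+1, t)) :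
  (i < t)%N -> (forall x y, A x y = F x y) ->
  minor (t - 1) A [:: 1; t.+1]%N [:: i.+1] =
  \det (\matrix_(x < t.-1, y < t.-1) F x.+1 (bump i y)).
Proof.
rewrite subn1 => ltit AE; have t_gt0 : (0 < t)%N by lia.
rewrite /minor; congr (\det _); apply/matrixP => x y; rewrite !mxE.
pose P (C : seq nat) z := z.+1 \notin C.
have fr : [seq z <- iota 0 t.+1 | P [:: 1; t.+1]%N z] = iota 1 t.-1.
  exact: filter_iota_ends.
have fc : [seq z <- iota 0 t | P [:: i.+1] z] = [seq bump i z | z <- iota 0 t.-1].
  exact: filter_iota_neq.
rewrite (nth_map ord0) ?(nth_map (Ordinal ltit)) ?AE.
- congr F.
    apply: etrans (nth_filter_enum _ _ (P [:: 1; t.+1]%N) _ _) _; rewrite fr.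
      by rewrite size_iota.
    by rewrite nth_iota.
  apply: etrans (nth_filter_enum _ _ (P [:: i.+1]) _ _) _; rewrite fc.
    by rewrite size_map size_iota.
  by rewrite (nth_map 0%N) ?size_iota // nth_iota.
- rewrite -(size_map val) -(filter_map val (P [:: i.+1])) val_enum_ord fc.
  by rewrite size_map size_iota.
- rewrite -(size_map val) -(filter_map val (P [:: 1; t.+1]%N)) val_enum_ord fr.
  by rewrite size_iota.
Qed.

(** Summand j is T_j - T_(j+1), so only the two ends of the path survive. Later [d] is the indicator
    of a vertex along the path; at an inner vertex the right-hand side is then 0. *)
Lemma path_minor_telescope (t : nat) (a b : nat -> int) (d : nat -> int) :
  (0 < t)%N ->
  \sum_(j < t) (-1) ^+ j * path_minor a b t j * (a j * d j + b j * d j.+1) =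
  d 0%N * (\prod_(j < t) a j) - (-1) ^+ t * d t * (\prod_(j < t) b j).
Proof.
move=> t_gt0.
pose T (j : nat) := (-1) ^+ j * d j * (\prod_(i < j) b i * \prod_(j <= i < t) a i).
have -> : d 0%N * (\prod_(j < t) a j) = T 0%N.
  by rewrite /T big_ord0 big_mkord !mul1r.
have -> : (-1) ^+ t * d t * \prod_(j < t) b j = T t.
  by rewrite /T [\prod_(t <= i < t) _]big_geq // mulr1.
rewrite -opprB -(telescope_sumr T) // big_mkord -sumrN.
apply: eq_bigr => j _; rewrite /T /path_minor.
rewrite [\prod_(j <= i < t) _]big_ltn // big_ord_recr /= exprS.
have -> : \prod_(j.+1 <= i < t) a i = \prod_(j <= i < t.-1) a i.+1.
  by rewrite big_add1.
ring.
Qed.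

(** Column y of a path has its start entry in row y and its end entry in row y + 1, so the matrix is
    bidiagonal and [det_path_minor] applies. *)
Lemma minor_path (E : nat -> nat -> int) (f g : nat -> nat) (rs : seq nat)
    (s t i : nat) (A : 'M[int]_(t.+1, t)) :
  uniq rs -> take t rs = map f (iota s t) -> behead rs = map g (iota s t) ->
  (forall r c, r \in rs -> c \in iota s t -> r != f c -> r != g c -> E r c = 0) ->
  (forall x y, A x y = E (nth 0%N rs x) (nth 0%N (iota s t) y)) -> (i < t)%N ->
  minor (t - 1) A [:: 1; t.+1]%N [:: i.+1] =
  path_minor (fun j => E (f (s + j)%N) (s + j)%N)
             (fun j => E (g (s + j)%N) (s + j)%N) t i.
Proof.
move=> Urs takeE behE E0 AE ltit.
have t_gt0 : (0 < t)%N by lia.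
have szr : size rs = t.+1.
  have := congr1 size behE; rewrite size_behead size_map size_iota; lia.
set a := fun j => E (f _) _; set b := fun j => E (g _) _.
have fE j : (j < t)%N -> nth 0%N rs j = f (s + j)%N.
  by move=> ltjt; rewrite -(nth_take 0%N ltjt) takeE (nth_map 0%N) ?size_iota ?nth_iota.
have gE j : (j < t)%N -> nth 0%N rs j.+1 = g (s + j)%N.
  by move=> ltjt; rewrite -nth_behead behE (nth_map 0%N) ?size_iota ?nth_iota.
rewrite (minor_ends _ _ (bidiagonal a b)) //; last first.
  move=> x y; rewrite AE nth_iota // /bidiagonal /a /b.
  case: eqP => [->|/eqP nxy]; first by rewrite fE.
  case: eqP => [->|/eqP nxy']; first by rewrite gE.
  apply: E0; rewrite ?mem_nth ?szr ?mem_iota -?fE -?gE //; try by have := ltn_ord y; lia.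
  - by rewrite nth_uniq ?szr // ltnW // ltnS.
  - by rewrite nth_uniq ?szr // ltnS.
by rewrite det_path_minor ?prednK //; lia.
Qed.

(** * Reindexing, injectivity and iterated gcds *)

Lemma big_iota_ord (R : Type) (idx : R) (op : R -> R -> R) (s t : nat) (F : nat -> R) :
  \big[op/idx]_(c <- iota s t) F c = \big[op/idx]_(j < t) F (s + j)%N.
Proof. by rewrite -{1}[s]addn0 iotaDl big_map -{1}[t]subn0 big_mkord. Qed.

Lemma uniq_map_inj (T1 T2 : eqType) (f : T1 -> T2) (s : seq T1) :
  uniq (map f s) -> {in s &, injective f}.
Proof.
elim: s => // x s IHs /= /andP[fx_notin Ufs] y z; rewrite !inE.
case/predU1P => [->|ys] /predU1P[->|zs] // eq_f.
- by rewrite eq_f map_f in fx_notin.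
- by rewrite -eq_f map_f in fx_notin.
- exact: IHs.
Qed.

Lemma dvdn_biggcd (T : Type) (s : seq T) (F : T -> nat) (d : nat) :
  (d %| \big[gcdn/0%N]_(x <- s) F x)%N = all (fun x => d %| F x)%N s.
Proof. by elim: s => [|x s IHs]; rewrite ?big_nil ?dvdn0 // big_cons dvdn_gcd IHs. Qed.

Lemma muln_biggcdr (T : Type) (s : seq T) (F : T -> nat) (a : nat) :
  (a * \big[gcdn/0%N]_(x <- s) F x = \big[gcdn/0%N]_(x <- s) (a * F x))%N.
Proof. by elim: s => [|x s IHs]; rewrite ?big_nil ?muln0 // !big_cons muln_gcdr IHs. Qed.

(** * Toric ideals of rank-one lattices *)

Section ToricIdeal.
Variables (K : fieldType) (nv ne : nat) (D : wograph nv ne).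

Implicit Types u w : 'X_{1..ne}.

Definition in_kernel (b : 'I_ne -> int) : Prop :=
  forall z, \sum_x incidence D z x * b x = 0.

(** The vector A u. The absolute value only casts the nonnegative entries of A to [nat]. *)
Definition toric_exponent u : 'X_{1..nv} :=
  [multinom (\sum_(x < ne) (u x * `|incidence D z x|))%N | z < nv].

Lemma toric_mapX u : toric_map D ('X_[u] : {mpoly K[ne]}) = 'X_[toric_exponent u].
Proof.
rewrite /toric_map comp_mpolyX.
under eq_bigr => x _ do
  rewrite tnth_mktuple mpolyXn -mpolyXD.
rewrite mprodXnE; congr 'X_[_]; apply/mnmP => z.
rewrite mnmE mnm_sumE; apply: eq_bigr => x _.
rewrite mulmnE mulnC; congr (_ * _)%N.
rewrite mnmDE mulmnE !mnm1E mxE [src D x == z]eq_sym [tgt D x == z]eq_sym.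
(* Without loops the source is not also the target, so its exponent receives no extra weight. *)
case: eqP => [->|_]; first by rewrite (negPf (wograph_loopless D x)) mul0n.
by case: eqP => [->|_]; rewrite ?mul1n ?mul0n ?absz0 ?absz_nat.
Qed.

Lemma toric_exponent_eq u w :
  toric_exponent u = toric_exponent w <->
  in_kernel (fun x => (u x)%:Z - (w x)%:Z).
Proof.
have incE z x : incidence D z x = `|incidence D z x|%N.
  by rewrite mxE; case: eqP => // _; case: eqP.
have sumE z : \sum_x incidence D z x * ((u x)%:Z - (w x)%:Z) =
    (toric_exponent u z)%:Z - (toric_exponent w z)%:Z.
  rewrite !mnmE !(big_morph Posz PoszD (erefl _)) -sumrB.
  by apply: eq_bigr => x _; rewrite incE !PoszM; ring.
split=> [eq_uw z | kuw]; first by rewrite sumE eq_uw subrr.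
apply/mnmP => z; apply/eqP; rewrite -eqz_nat -subr_eq0 -sumE.
by apply/eqP/kuw.
Qed.

Lemma toric_idealX u w :
  ('X_[u] - 'X_[w] \in toric_ideal D K) = (toric_exponent u == toric_exponent w).
Proof.
rewrite -topredE /= /toric_ideal /toric_map comp_mpolyB -!/(toric_map D _).
rewrite !toric_mapX subr_eq0; apply/eqP/eqP => [eqX|-> //].
have := congr1 (mcoeff (toric_exponent u)) eqX.
by rewrite !mcoeffX eqxx; case: eqP => [->|] // _ /eqP; rewrite oner_eq0.
Qed.

Variable b : 'I_ne -> int.
Hypothesis b_kernel : in_kernel b.
Hypothesis b_neq0 : exists x, b x != 0.
Hypothesis b_span : forall c, in_kernel c -> exists t : int, forall x, c x = t * b x.

Definition pos_exponent : 'X_{1..ne} :=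
  [multinom (if (0 < b x)%R then `|b x|%N else 0%N) | x < ne].
Definition neg_exponent : 'X_{1..ne} :=
  [multinom (if (b x < 0)%R then `|b x|%N else 0%N) | x < ne].

Let f : {mpoly K[ne]} := 'X_[pos_exponent] - 'X_[neg_exponent].

Lemma pos_sub_neg x : (pos_exponent x)%:Z - (neg_exponent x)%:Z = b x.
Proof. by rewrite !mnmE; case: ifP; case: ifP; lia. Qed.

Lemma binomial_in_ideal : f \in toric_ideal D K.
Proof.
rewrite toric_idealX; apply/eqP/toric_exponent_eq => z.
by under eq_bigr do rewrite pos_sub_neg; apply: b_kernel.
Qed.

(** Let u - w = t b. If t > 0, the positive part of b divides u; replacing it by the negative part
    changes e^u by a multiple of [f] and lowers t by one. If t < 0, u and w are exchanged. *)
Lemma dvd_monomial_diff u w :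
  toric_exponent u = toric_exponent w ->
  exists h, 'X_[u] - 'X_[w] = h * f.
Proof.
have nonneg (t : nat) u' w' :
    (forall x, (u' x)%:Z - (w' x)%:Z = t%:Z * b x) ->
    exists h, 'X_[u'] - 'X_[w'] = h * f.
  elim: t u' => [|t IHt] u' uw.
    exists 0; rewrite mul0r; apply/eqP; rewrite subr_eq0; apply/eqP.
    by congr 'X_[_]; apply/mnmP => x; move: (uw x); lia.
  have le_pos : (pos_exponent <= u')%MM.
    by apply/mnm_lepP => x; rewrite mnmE; case: ifP => // ?; move: (uw x); nia.
  have [|h hE] := IHt (u' - pos_exponent + neg_exponent)%MM.
    move=> x; have := mnm_lepP le_pos x; have := pos_sub_neg x.
    by rewrite mnmDE mnmBE; move: (uw x); nia.
  exists (h + 'X_[u' - pos_exponent]); rewrite mulrDl -hE /f mulrBr -!mpolyXD.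
  by rewrite submK //; ring.
move=> /toric_exponent_eq /b_span [[t|t] tE]; first exact: nonneg tE.
have [|h hE] := nonneg t.+1 w u.
  by move=> x; move: (tE x); rewrite NegzE; lia.
by exists (- h); rewrite mulNr -hE opprB.
Qed.

(** Subtracting from each monomial of g a fixed representative of its fibre under the toric map
    writes g as a combination of binomials in the ideal, each a multiple of [f] by
    [dvd_monomial_diff]. *)
Lemma binomial_generates : generates f (toric_ideal D K).
Proof.
move=> g; split=> [|[h ->]]; last first.
  rewrite -topredE /= /toric_ideal /toric_map rmorphM /= -!/(toric_map D _).
  have /eqP -> : toric_map D f == 0 by exact: binomial_in_ideal.
  by rewrite mulr0.
rewrite -topredE /= => /eqP g0.
(* The choice depends only on the predicate, so [rho] is constant on each fibre. *)
pose rho u := choose (fun w => toric_exponent w == toric_exponent u) u.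
have rhoE u : toric_exponent (rho u) = toric_exponent u.
  by apply/eqP; apply: (chooseP (P := fun w => toric_exponent w == _)).
have rho_eq u w : (rho u == rho w) = (toric_exponent u == toric_exponent w).
  apply/eqP/eqP => [eq_rho|eq_uw]; first by rewrite -rhoE eq_rho rhoE.
  rewrite /rho eq_uw; apply: choose_id => //; exact/eqP.
(* At a representative w the coefficient is the sum of g over the fibre of w, which is a coefficient
   of the image of g, hence 0. Any other w is never a value of [rho]. *)
have sum0 : \sum_(u <- msupp g) g@_u *: 'X_[rho u] = 0 :> {mpoly K[ne]}.
  apply/mpolyP => w; rewrite mcoeff0 raddf_sum /=.
  under eq_bigr do rewrite mcoeffZ mcoeffX.
  have [w_rho|w_rho] := eqVneq w (rho w); last first.
    rewrite big1 // => u _; case: eqP => [eq_w|_]; rewrite ?mulr0 //.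
    by case/eqP: w_rho; apply/eqP; rewrite -{1}eq_w rho_eq -eq_w rhoE.
  have := congr1 (mcoeff (toric_exponent w)) g0.
  rewrite mcoeff0 /toric_map comp_mpolyEX raddf_sum /=.
  move=> sum_w; rewrite -[RHS]sum_w; apply: eq_bigr => u _.
  rewrite -/(toric_map D _) toric_mapX mcoeffZ mcoeffX.
  by rewrite {1}w_rho rho_eq.
have -> : g = \sum_(u <- msupp g) g@_u *: ('X_[u] - 'X_[rho u]).
  under eq_bigr do rewrite scalerBr.
  by rewrite sumrB sum0 subr0 -mpolyE.
elim: (msupp g) => [|u s [h hE]]; first by exists 0; rewrite big_nil mul0r.
have [h' h'E] := dvd_monomial_diff u (rho u) (esym (rhoE u)).
exists (g@_u *: h' + h); by rewrite big_cons hE h'E mulrDl scalerAl.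
Qed.

Lemma binomial_primitive : primitive D f.
Proof.
have [x0 bx0] := b_neq0.
exists pos_exponent, neg_exponent; split=> //.
- rewrite /f subr_eq0; apply/eqP => /(congr1 (mcoeff pos_exponent)).
  rewrite !mcoeffX eqxx; case: eqP => [eq_pn _|_ /eqP]; last by rewrite oner_eq0.
  by move: (pos_sub_neg x0); rewrite eq_pn subrr => /esym/eqP; rewrite (negPf bx0).
- exact: binomial_in_ideal.
move=> w w' nz; rewrite toric_idealX => /eqP/toric_exponent_eq/b_span [t tE].
move=> /mnm_lepP le_w /mnm_lepP le_w'.
have t_neq0 : t != 0.
  apply: contraNneq nz => t0; rewrite subr_eq0; apply/eqP; congr 'X_[_].
  by apply/mnmP => x; move: (tE x); rewrite t0 mul0r; lia.
(* At x0 one of the two exponents of [f] is 0, so t |b x0| lies between 0 and |b x0|, while t and b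
   x0 are nonzero. *)
have t1 : t = 1.
  move: (tE x0) (le_w x0) (le_w' x0); rewrite !mnmE.
  by case: ltgtP bx0 => // ? _; nia.
by split; apply/mnmP => x; move: (tE x) (le_w x) (le_w' x); rewrite t1 !mnmE;
  case: ltgtP; lia.
Qed.

End ToricIdeal.

(** * The kernel of the incidence matrix of two cycles sharing a path *)

(* Start and end, in the direction in which its path is traversed in the
   labelling, of the edge with label c. This is unrelated to its orientation. *)
Definition start_label (m k c : nat) : nat :=
  if (c <= m)%N then c else if c == m.+1 then k.+1 else c.-1.
Definition end_label (m l c : nat) : nat :=
  if (c < m)%N then c.+1 else if (c == m) || (c == l) then 1%N else c.

Lemma map_start_iota (m k s t : nat) : (s + t <= m.+1)%N ->
  map (start_label m k) (iota s t) = iota s t.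
Proof.
move=> le_st; apply: map_id_in => c; rewrite mem_iota /start_label => ?.
by rewrite ifT //; lia.
Qed.

Lemma map_end_iota (m l s t : nat) : (s + t <= m)%N ->
  map (end_label m l) (iota s t) = iota s.+1 t.
Proof.
move=> le_st; rewrite -add1n iotaDl; apply/eq_in_map => c.
by rewrite mem_iota /end_label => ?; rewrite ifT //; lia.
Qed.

Lemma map_end_iota_last (m l s t : nat) : (0 < t)%N -> (s + t = m.+1)%N ->
  map (end_label m l) (iota s t) = rcons (iota s.+1 t.-1) 1%N.
Proof.
case: t => // t _ st; rewrite -addn1 iotaD map_cat map_end_iota; last by lia.
by rewrite /= -cats1 addn1 /end_label ifF ?ifT //; lia.
Qed.

Lemma map_start_iota_r (m k t : nat) : (0 < t)%N ->
  map (start_label m k) (iota m.+1 t) = k.+1 :: iota m.+1 t.-1.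
Proof.
case: t => // t _; rewrite /= /start_label ltnn eqxx; congr (_ :: _).
rewrite -[m.+2]add1n iotaDl -map_comp -[RHS]map_id; apply/eq_in_map => c.
by rewrite mem_iota /= => ?; rewrite ifF ?ifF //; lia.
Qed.

Lemma map_end_iota_r (m l t : nat) : (0 < t)%N -> (m + t = l)%N ->
  map (end_label m l) (iota m.+1 t) = rcons (iota m.+1 t.-1) 1%N.
Proof.
case: t => // t _ mtl; rewrite -[t.+1]addn1 iotaD map_cat /= -cats1 addn1.
congr (_ ++ [:: _]); last by rewrite /end_label ifF ?ifT //; lia.
apply: map_id_in => c; rewrite mem_iota /end_label => ?.
by rewrite ifF ?ifF //; lia.
Qed.

Section Edges.
Variables (nv ne : nat) (D : wograph nv ne).

Lemma joins_neq x a b : joins D x a b -> a != b.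
Proof.
move=> /eqP eq_ab; apply: contra (wograph_loopless D x) => /eqP ab.
have : src D x \in [set a; b] by rewrite -eq_ab !inE eqxx.
have : tgt D x \in [set a; b] by rewrite -eq_ab !inE eqxx orbT.
by rewrite !inE ab !orbb => /eqP -> /eqP ->.
Qed.

Lemma incidence_eq0 x a b z :
  joins D x a b -> z != a -> z != b -> incidence D z x = 0.
Proof.
move=> /eqP eq_ab za zb; have := in_set2 z a b.
by rewrite -eq_ab (negPf za) (negPf zb) !inE mxE; do 2 case: eqP => //.
Qed.

Lemma incidence_gt0 x a b :
  joins D x a b -> 0 < incidence D a x /\ 0 < incidence D b x.
Proof.
move=> /eqP eq_ab; have inc_gt0 z : z \in [set src D x; tgt D x] -> 0 < incidence D z x.
  by rewrite !inE mxE; do 2 case: eqP => //; rewrite ltz_nat wograph_wt_gt0.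
by rewrite !inc_gt0 // eq_ab !inE eqxx ?orbT.
Qed.

Lemma is_cycle_joins (v : nat -> 'I_nv) (e : nat -> 'I_ne) (rs cs : seq nat)
    (f g : nat -> nat) :
  rs = map f cs -> rot 1 rs = map g cs ->
  is_cycle D (map v rs) (map e cs) ->
  forall c, c \in cs -> joins D (e c) (v (f c)) (v (g c)).
Proof.
move=> rsE rotE /and5P[_ _ _ _]; rewrite -map_rot rotE rsE -!map_comp !zip_map.
by rewrite all_map => /allP joins_cs c /joins_cs.
Qed.

End Edges.

Section TwoCycles.
Variables (nv ne : nat) (D : wograph nv ne) (m n k : nat).
Variables (v : nat -> 'I_nv) (e : nat -> 'I_ne).
Hypotheses (k_gt0 : (0 < k)%N) (lt_km : (k < m)%N) (lt_kn : (k < n)%N).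

Local Notation N := (m + n - k)%N.
Local Notation tl := (start_label m k).
Local Notation hd := (end_label m N).

Lemma start_label_bound c : c \in iota 1 N -> tl c \in iota 1 N.-1.
Proof.
by rewrite !mem_iota /start_label => ?; case: (leqP c m) => ?; [|case: eqP => ?]; lia.
Qed.

Lemma end_label_bound c : c \in iota 1 N -> hd c \in iota 1 N.-1.
Proof.
by rewrite !mem_iota /end_label => ?; case: (ltnP c m) => ?; [|case: ifP => ?]; lia.
Qed.

Lemma rCm_start : rCm m = map tl (cCm m).
Proof. by rewrite map_start_iota. Qed.

Lemma rot_rCm : rot 1 (rCm m) = map hd (cCm m).
Proof.
rewrite /rCm /cCm map_end_iota_last //; last by lia.
by case: (m) lt_km => // m' _; rewrite rot1_cons.
Qed.

Lemma rCn_start : rCn m n k = map tl (cCn m n k).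
Proof.
rewrite /rCn /cCn map_cat map_start_iota ?map_start_iota_r; try lia.
by rewrite -[k.+1]addn1 iotaD -catA /= subn1 add1n addn1.
Qed.

Lemma rot_rCn : rot 1 (rCn m n k) = map hd (cCn m n k).
Proof.
rewrite /rCn /cCn map_cat map_end_iota ?map_end_iota_r; try lia.
by rewrite rot1_cons subn1 -rcons_cat.
Qed.

(** The outer cycle runs through C_m \ P backwards, so start and end of an edge are exchanged on
    that part. *)
Lemma rC_ends : rC m n k =
  map hd (rev (iota k.+1 (m - k))) ++ map tl (iota m.+1 (n - k)).
Proof.
rewrite map_rev map_end_iota_last ?map_start_iota_r; try lia.
rewrite rev_rcons /rC; congr (_ :: _).
case: (m - k)%N (subn_gt0 k m) => [|a]; first by rewrite lt_km.
by move=> _; rewrite /= rev_cons cat_rcons subn1.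
Qed.

Lemma rot_rC : rot 1 (rC m n k) =
  map tl (rev (iota k.+1 (m - k))) ++ map hd (iota m.+1 (n - k)).
Proof.
rewrite map_rev map_start_iota ?map_end_iota_r; try lia.
by rewrite rot1_cons subn1 -rcons_cat.
Qed.

Lemma uniq_rCn : uniq (rCn m n k).
Proof.
rewrite /rCn cat_uniq !iota_uniq andbT.
by apply/hasPn => c; rewrite !mem_iota; lia.
Qed.

Lemma uniq_rC : uniq (rC m n k).
Proof.
rewrite /rC cons_uniq cat_uniq rev_uniq !iota_uniq andbT.
rewrite mem_cat mem_rev !mem_iota; apply/andP; split; first by lia.
by apply/hasPn => c; rewrite mem_rev !mem_iota; lia.
Qed.

Lemma iota_labels :
  iota 1 N = iota 1 k ++ iota k.+1 (m - k) ++ iota m.+1 (n - k).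
Proof.
rewrite (_ : N = k + ((m - k) + (n - k)))%N; last by lia.
by rewrite !iotaD (_ : 1 + k + (m - k) = m.+1)%N //; lia.
Qed.

(** * Entries, cycle determinants and path minors in terms of the labels *)

Local Notation E := (fun r c => incidence D (v r) (e c)).
Local Notation q := (qdet m D v e).
Local Notation p := (pdet m n k D v e).
Local Notation s := (sdet m n k D v e).

Hypothesis v_perm : perm_eq [seq v i | i <- iota 1 (N - 1)] (enum 'I_nv).
Hypothesis e_perm : perm_eq [seq e i | i <- iota 1 N] (enum 'I_ne).
Hypothesis cycle_m : is_cycle D [seq v i | i <- rCm m] [seq e i | i <- cCm m].
Hypothesis cycle_n :
  is_cycle D [seq v i | i <- rCn m n k] [seq e i | i <- cCn m n k].

Lemma edge_joins c : c \in iota 1 N -> joins D (e c) (v (tl c)) (v (hd c)).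
Proof.
have joins_m := is_cycle_joins _ _ _ _ _ _ _ _ _ rCm_start rot_rCm cycle_m.
have joins_n := is_cycle_joins _ _ _ _ _ _ _ _ _ rCn_start rot_rCn cycle_n.
rewrite mem_iota => c_bound; have [le_cm|lt_mc] := leqP c m.
  by apply: joins_m; rewrite mem_iota; lia.
by apply: joins_n; rewrite mem_cat !mem_iota; lia.
Qed.

Lemma v_inj : {in iota 1 (N - 1) &, injective v}.
Proof. by apply: uniq_map_inj; rewrite (perm_uniq v_perm) enum_uniq. Qed.

Lemma e_uniq : uniq [seq e i | i <- iota 1 N].
Proof. by rewrite (perm_uniq e_perm) enum_uniq. Qed.

Lemma label_edge x : exists2 c, c \in iota 1 N & x = e c.
Proof. by apply/mapP; rewrite (perm_mem e_perm) mem_enum. Qed.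

Lemma label_vertex z : exists2 r, r \in iota 1 (N - 1) & z = v r.
Proof. by apply/mapP; rewrite (perm_mem v_perm) mem_enum. Qed.

Lemma entry_eq0 r c : r \in iota 1 (N - 1) -> c \in iota 1 N ->
  r != tl c -> r != hd c -> E r c = 0.
Proof.
rewrite subn1 => rN cN rt rh; apply: (incidence_eq0 _ _ _ _ _ _ _ (edge_joins _ cN)).
  apply: contra rt => /eqP/v_inj ->; rewrite ?subn1 //; exact: start_label_bound.
by apply: contra rh => /eqP/v_inj ->; rewrite ?subn1 //; exact: end_label_bound.
Qed.

(** The two ends of an edge are distinct, so at most one indicator is 1. This is the shape a_j d_j +
    b_j d_(j+1) of [path_minor_telescope]. *)
Lemma entryE r c : r \in iota 1 (N - 1) -> c \in iota 1 N ->
  E r c = E (tl c) c * (r == tl c)%:R + E (hd c) c * (r == hd c)%:R.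
Proof.
move=> rN cN; have := joins_neq _ _ _ _ _ _ (edge_joins _ cN).
have [-> nth|rt _] := eqVneq r (tl c).
  rewrite (_ : (tl c == hd c) = false) ?mulr0 ?addr0 ?mulr1 //.
  by apply: contraNF nth => /eqP <-.
have [->|rh] := eqVneq r (hd c); first by rewrite mulr0 add0r mulr1.
by rewrite entry_eq0 // !mulr0 addr0.
Qed.

(** The six path products are [al] and [be] at (1, k), (k+1, m-k) and (m+1, n-k), that is, on P, C_m
    \ P and C_n \ P. *)
Let al s t := \prod_(j < t) E (tl (s + j)%N) (s + j)%N.
Let be s t := \prod_(j < t) E (hd (s + j)%N) (s + j)%N.

Lemma qdetE : q = al 1 k * al k.+1 (m - k) - (-1) ^+ m * (be 1 k * be k.+1 (m - k)).
Proof.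
transitivity (\det (\matrix_(i < m, j < m) E (nth 0%N (rCm m) i) (nth 0%N (cCm m) j))).
  by [].
rewrite (det_cycle E tl hd) ?size_iota ?iota_uniq ?rot_rCm -?rCm_start //; last first.
- by move=> r c; rewrite !mem_iota => rm cm; apply: entry_eq0; rewrite mem_iota; lia.
- lia.
have cE : cCm m = iota 1 k ++ iota k.+1 (m - k) by rewrite -iotaD subnKC // ltnW.
by rewrite cE !big_cat !big_iota_ord.
Qed.

Lemma pdetE : p = al 1 k * al m.+1 (n - k) - (-1) ^+ n * (be 1 k * be m.+1 (n - k)).
Proof.
transitivity (\det (\matrix_(i < n, j < n)
    E (nth 0%N (rCn m n k) i) (nth 0%N (cCn m n k) j))); first by [].
rewrite (det_cycle E tl hd) ?uniq_rCn ?rot_rCn -?rCn_start //; last first.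
- move=> r c; rewrite !mem_cat !mem_iota => rm cm.
  by apply: entry_eq0; rewrite mem_iota; lia.
- lia.
- by rewrite size_cat !size_iota subnKC // ltnW.
by rewrite !big_cat !big_iota_ord.
Qed.

Lemma sdetE :
  s = be k.+1 (m - k) * al m.+1 (n - k) -
      (-1) ^+ (m + n) * (al k.+1 (m - k) * be m.+1 (n - k)).
Proof.
transitivity (\det (\matrix_(i < m + n - k.*2, j < m + n - k.*2)
    E (nth 0%N (rC m n k) i) (nth 0%N (cC m n k) j))); first by [].
pose f c := if (c <= m)%N then hd c else tl c.
pose g c := if (c <= m)%N then tl c else hd c.
have fgE h h' : map (fun c => if (c <= m)%N then h c else h' c) (cC m n k) =
    map h (rev (iota k.+1 (m - k))) ++ map h' (iota m.+1 (n - k)) :> seq nat.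
  rewrite map_cat; congr (_ ++ _); apply/eq_in_map => c.
    by rewrite mem_rev mem_iota => ?; rewrite ifT //; lia.
  by rewrite mem_iota => ?; rewrite ifF //; lia.
rewrite (det_cycle E f g) ?uniq_rC ?fgE -?rC_ends ?rot_rC //; last first.
- move=> r c; rewrite !inE !mem_cat !mem_rev !mem_iota => rm cm rf rg.
  apply: entry_eq0; rewrite ?mem_iota; try lia.
    by move: rf rg; rewrite /f /g; case: ifP.
  by move: rf rg; rewrite /f /g; case: ifP.
- lia.
- by rewrite size_cat size_rev !size_iota; lia.
have prodE h h' : \prod_(c <- cC m n k) (if (c <= m)%N then h c else h' c) =
    (\prod_(j < m - k) h (k.+1 + j)%N) * \prod_(j < n - k) h' (m.+1 + j)%N :> int.
  rewrite big_cat (perm_big _ (permEl (perm_rev _))) /= !big_iota_ord.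
  congr (_ * _); apply: eq_bigr => j _; have := ltn_ord j.
    by move=> ?; rewrite ifT //; lia.
  by move=> ?; rewrite ifF //; lia.
have -> : be k.+1 (m - k) * al m.+1 (n - k) = _ :=
  esym (prodE (fun c => E (hd c) c) (fun c => E (tl c) c)).
have -> : al k.+1 (m - k) * be m.+1 (n - k) = _ :=
  esym (prodE (fun c => E (tl c) c) (fun c => E (hd c) c)).
(* The outer cycle has m + n - 2k edges, and 2k does not affect the sign. *)
rewrite -signr_odd (_ : odd (m + n - k.*2) = odd (m + n)); last first.
  by rewrite oddB ?odd_double ?addbF //; lia.
rewrite signr_odd; congr (_ - _ * _); apply: eq_bigr => c _.
  by rewrite /f; case: ifP.
by rewrite /g; case: ifP.
Qed.

Let pm s t j := path_minor (fun j => E (tl (s + j)%N) (s + j)%N)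
                           (fun j => E (hd (s + j)%N) (s + j)%N) t j.

Lemma r_PE j : (j < k)%N -> r_P k D v e j.+1 = pm 1 k j.
Proof.
move=> ltjk; apply: (minor_path E tl hd (rP k)) => //.
- exact: iota_uniq.
- by rewrite map_start_iota ?take_iota; [rewrite (minn_idPl _) | lia].
- by rewrite map_end_iota; [| lia].
- by move=> r c; rewrite !mem_iota => rm cm; apply: entry_eq0; rewrite mem_iota; lia.
- by move=> x y; rewrite mxE.
Qed.

Lemma r_CmE j : (j < m - k)%N -> r_Cm m k D v e j.+1 = pm k.+1 (m - k) j.
Proof.
move=> ltjk; apply: (minor_path E tl hd (rCmP m k)) => //.
- by rewrite rcons_uniq iota_uniq mem_iota; lia.
- rewrite map_start_iota; last by lia.
  by rewrite /rCmP -cats1 take_cat size_iota ltnn subnn cats0.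
- rewrite map_end_iota_last /rCmP; [|lia..].
  by case: (m - k)%N ltjk.
- move=> r c; rewrite mem_rcons inE !mem_iota => rm cm.
  by apply: entry_eq0; rewrite mem_iota; lia.
- by move=> x y; rewrite mxE.
Qed.

Lemma r_CnE j : (j < n - k)%N -> r_Cn m n k D v e j.+1 = pm m.+1 (n - k) j.
Proof.
move=> ltjk; apply: (minor_path E tl hd (rCnP m n k)) => //.
- rewrite /rCnP cons_uniq rcons_uniq mem_rcons inE iota_uniq !mem_iota; lia.
- rewrite map_start_iota_r /rCnP; last by lia.
  rewrite -rcons_cons -cats1 take_cat /= size_iota subn1 prednK ?ltnn ?subnn ?cats0 //.
  lia.
- by rewrite map_end_iota_r /rCnP ?subn1; [| lia..].
- move=> r c; rewrite inE mem_rcons inE !mem_iota => rm cm.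
  by apply: entry_eq0; rewrite mem_iota; lia.
- by move=> x y; rewrite mxE.
Qed.

(** * The kernel vector before division by the gcd *)

Local Notation c_ := (fun c => (cpc_num m n k D v e)`_c.-1).

(** With i = j + 1 each coefficient is (-1)^j times a minor times a factor constant along the path:
    s here, (-1)^(m-k) p and -(-1)^(m-k) q on the other two. These factors are the [sg] of
    [path_sum]. *)
Lemma c_P j : (j < k)%N -> c_ (1 + j)%N = (-1) ^+ j * s * pm 1 k j.
Proof.
move=> ltjk; rewrite /= /cpc_num nth_cat size_map size_iota ltjk.
rewrite (nth_map 0%N) ?size_iota // nth_iota // add1n r_PE //.
by rewrite addn1 !exprS; ring.
Qed.

Lemma c_Cm j : (j < m - k)%N ->
  c_ (k.+1 + j)%N = (-1) ^+ (m - k) * (-1) ^+ j * p * pm k.+1 (m - k) j.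
Proof.
move=> ltj; rewrite /= /cpc_num nth_cat size_map size_iota.
rewrite ltnNge leq_addr /= addKn nth_cat size_map size_iota ltj.
rewrite (nth_map 0%N) ?size_iota // nth_iota // add1n r_CmE //.
by rewrite addn1 addSn !exprS exprD; ring.
Qed.

Lemma c_Cn j : (j < n - k)%N ->
  c_ (m.+1 + j)%N = - ((-1) ^+ (m - k) * (-1) ^+ j * q * pm m.+1 (n - k) j).
Proof.
move=> ltj; rewrite /= /cpc_num nth_cat size_map size_iota.
rewrite ifF; last by lia.
rewrite nth_cat size_map size_iota ifF; last by lia.
rewrite (_ : m + j - k - (m - k) = j)%N; last by lia.
rewrite (nth_map 0%N) ?size_iota // nth_iota // add1n r_CnE //.
by rewrite addSn !exprS exprD; ring.
Qed.

Lemma edge_sum (F : 'I_ne -> int) : \sum_x F x = \sum_(c <- iota 1 N) F (e c).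
Proof. by rewrite -(big_map e xpredT F) (perm_big _ e_perm) big_enum. Qed.

(** The contribution of one path to the equation at the vertex r, by telescoping with the indicator
    of r along the vertices [ws]. *)
Lemma path_sum (s0 t : nat) (ws : seq nat) (sg : int) (r : nat) :
  (0 < t)%N -> {subset iota s0 t <= iota 1 N} -> r \in iota 1 (N - 1) ->
  take t ws = map tl (iota s0 t) -> behead ws = map hd (iota s0 t) ->
  (forall j, (j < t)%N -> c_ (s0 + j)%N = sg * (-1) ^+ j * pm s0 t j) ->
  \sum_(c <- iota s0 t) E r c * c_ c =
  sg * ((r == nth 0%N ws 0)%:R * al s0 t -
        (-1) ^+ t * (r == nth 0%N ws t)%:R * be s0 t).
Proof.
move=> t_gt0 subN rN takeE behE cE; rewrite big_iota_ord.
have fE j : (j < t)%N -> nth 0%N ws j = tl (s0 + j)%N.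
  by move=> ltjt; rewrite -(nth_take 0%N ltjt) takeE (nth_map 0%N) ?size_iota ?nth_iota.
have gE j : (j < t)%N -> nth 0%N ws j.+1 = hd (s0 + j)%N.
  by move=> ltjt; rewrite -nth_behead behE (nth_map 0%N) ?size_iota ?nth_iota.
have <- := path_minor_telescope t (fun j => E (tl (s0 + j)%N) (s0 + j)%N)
  (fun j => E (hd (s0 + j)%N) (s0 + j)%N) (fun j => (r == nth 0%N ws j)%:R) t_gt0.
rewrite mulr_sumr.
apply: eq_bigr => j _; rewrite cE // fE // gE // (entryE r (s0 + j)%N) //.
  by rewrite /pm; ring.
by apply: subN; rewrite mem_iota; have := ltn_ord j; lia.
Qed.

Lemma label_kernel r : r \in iota 1 (N - 1) -> \sum_(c <- iota 1 N) E r c * c_ c = 0.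
Proof.
move=> rN; rewrite iota_labels !big_cat.
rewrite (path_sum 1 k (rP k) s) //=; first last.
- by move=> j ltj; rewrite c_P //; ring.
- by rewrite map_end_iota; [| lia].
- by rewrite map_start_iota ?take_iota; [rewrite (minn_idPl _) | lia].
- by move=> c; rewrite !mem_iota; lia.
rewrite (path_sum k.+1 (m - k) (rCmP m k) ((-1) ^+ (m - k) * p)) //=; first last.
- by move=> j ltj; rewrite c_Cm //; ring.
- rewrite map_end_iota_last /rCmP; [|lia..].
  by case: (m - k)%N (subn_gt0 k m) => //; rewrite lt_km.
- rewrite map_start_iota; last by lia.
  by rewrite /rCmP -cats1 take_cat size_iota ltnn subnn cats0.
- by move=> c; rewrite !mem_iota; lia.
- by rewrite subn_gt0.
rewrite (path_sum m.+1 (n - k) (rCnP m n k) (- ((-1) ^+ (m - k) * q))) //=; first last.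
- by move=> j ltj; rewrite c_Cn //; ring.
- by rewrite map_end_iota_r /rCnP ?subn1; [| lia..].
- rewrite map_start_iota_r /rCnP; last by lia.
  rewrite -rcons_cons -cats1 take_cat /= size_iota subn1 prednK ?ltnn ?subnn ?cats0 //.
  lia.
- by move=> c; rewrite !mem_iota; lia.
- by rewrite subn_gt0.
(* P runs from v_1 to v_(k+1) and the other two paths run from v_(k+1) to v_1, so only these two
   vertices still contribute. *)
have -> : nth 0%N (1%N :: iota 2 k) k = k.+1.
  exact: (nth_iota 0%N 1 (ltnSn k)).
have -> : nth 0%N (rCmP m k) 0 = k.+1.
  by rewrite /rCmP; case: (m - k)%N (subn_gt0 k m) => //; rewrite lt_km.
have -> : nth 0%N (rCmP m k) (m - k) = 1%N.
  by rewrite /rCmP nth_rcons size_iota ltnn eqxx.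
have -> : nth 0%N (rCnP m n k) (n - k) = 1%N.
  rewrite /rCnP -rcons_cons nth_rcons /= size_iota subn1 prednK ?subn_gt0 //.
  by rewrite ltnn eqxx.
(* All signs now depend on the parities of the three path lengths; each of the eight cases is a
   polynomial identity. *)
have mE : m = (k + (m - k))%N by lia.
have nE : n = (k + (n - k))%N by lia.
rewrite sdetE pdetE qdetE [in (-1) ^+ m]mE [in (-1) ^+ n]nE.
rewrite [in (-1) ^+ (m + n)]mE [in (-1) ^+ (k + (m - k) + n)]nE !exprD.
rewrite -(signr_odd _ k) -(signr_odd _ (m - k)) -(signr_odd _ (n - k)).
by case: (odd k); case: (odd (m - k)); case: (odd (n - k)); rewrite ?expr0 ?expr1; ring.
Qed.

Lemma pm_gt0 s0 t j : {subset iota s0 t <= iota 1 N} -> (j < t)%N -> 0 < pm s0 t j.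
Proof.
move=> subN ltjt; have pos i : (i < t)%N ->
    0 < E (tl (s0 + i)%N) (s0 + i)%N /\ 0 < E (hd (s0 + i)%N) (s0 + i)%N.
  move=> ltit; apply: incidence_gt0; apply: edge_joins.
  by apply: subN; rewrite mem_iota; lia.
rewrite /pm /path_minor mulr_gt0 //.
  by apply: prodr_gt0 => i _; case: (pos i) => //; have := ltn_ord i; lia.
rewrite big_nat prodr_gt0 // => i ?; case: (pos i.+1) => //; lia.
Qed.

Hypothesis q_neq0 : q != 0.

(** Up to sign, this entry is q times a minor, and the minor is a product of positive incidence
    entries. *)
Lemma c_last_neq0 : c_ N != 0.
Proof.
have -> : N = (m.+1 + (n - k).-1)%N by lia.
rewrite c_Cn; last by lia.
rewrite oppr_eq0; apply: mulf_neq0; first by rewrite !mulf_neq0 ?signr_eq0.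
apply: lt0r_neq0; apply: pm_gt0 => [c|]; rewrite ?mem_iota; lia.
Qed.

(** Inverse to [e] on labels, which carries the vector listed by labels over to a function on edges.
    Labels start at 1, positions at 0. *)
Definition edge_label (x : 'I_ne) : nat := (index x [seq e i | i <- iota 1 N]).+1.

Lemma edge_labelK c : c \in iota 1 N -> edge_label (e c) = c.
Proof.
rewrite mem_iota => cN; have [i ltiN ->] : exists2 i, (i < N)%N & c = i.+1.
  by exists c.-1; lia.
rewrite /edge_label -[in e _]add1n -(nth_iota 0%N 1 ltiN).
by rewrite -(nth_map 0%N (e 0%N)) ?size_iota // index_uniq ?size_map ?size_iota ?e_uniq.
Qed.

Lemma cpc_in_kernel : in_kernel nv ne D (fun x => c_ (edge_label x)).
Proof.
move=> z; have [r rN ->] := label_vertex z; rewrite edge_sum -[RHS](label_kernel r rN).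
by apply: eq_big_seq => c cN; rewrite edge_labelK.
Qed.

(* A kernel vector that vanishes on the last edge vanishes along the whole path
   C_n \ P, whose inner vertices have degree 2; the rest lives on C_m. *)
Lemma kernel_last_eq0 (u : 'I_ne -> int) :
  in_kernel nv ne D u -> u (e N) = 0 -> forall x, u x = 0.
Proof.
move=> ku uN0.
have sum0 r : \sum_(c <- iota 1 N) E r c * u (e c) = 0.
  by move: (ku (v r)); rewrite edge_sum.
(* Descent from e_N: the vertex v_(N-i-1) lies only on e_(N-i-1) and e_(N-i), and has a positive
   entry on the former. *)
have tail0 i : (i < n - k)%N -> u (e (N - i)%N) = 0.
  elim: i => [|i IHi] lti; first by rewrite subn0.
  have rN : (N - i.+1)%N \in iota 1 (N - 1) by rewrite mem_iota; lia.
  have rN' : (N - i.+1)%N \in iota 1 N by rewrite mem_iota; lia.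
  have hdr : hd (N - i.+1)%N = (N - i.+1)%N by rewrite /end_label ifF ?ifF //; lia.
  have [_] := incidence_gt0 _ _ _ _ _ _ (edge_joins _ rN'); rewrite hdr => r_gt0.
  have := sum0 (N - i.+1)%N; rewrite (bigD1_seq _ rN' (iota_uniq _ _)) /=.
  rewrite big1_seq ?addr0 => [/eqP|c /andP[cr cN]].
    by rewrite mulf_eq0 gt_eqF //= => /eqP.
  have [->|cr'] := eqVneq c (N - i)%N; first by rewrite IHi ?mulr0 //; lia.
  rewrite entry_eq0 ?mul0r //.
    by move: cr cr'; rewrite /start_label; case: ifP => ?; [|case: ifP => ?]; lia.
  move: cN cr cr'; rewrite mem_iota /end_label.
  by case: ifP => ?; [|case: ifP => ?]; lia.
have cyc0 i : (i < m)%N -> u (e i.+1) = 0.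
  pose A := subincidence D v e m m (rCm m) (cCm m).
  pose w : 'cV[int]_m := \col_j u (e j.+1).
  have Aw0 : A *m w = 0.
    apply/matrixP => r j; rewrite !mxE -[RHS](sum0 r.+1).
    rewrite (_ : N = m + (n - k))%N; last by lia.
    rewrite iotaD big_cat /= [X in _ = _ + X]big1_seq ?addr0.
      rewrite big_iota_ord; apply: eq_bigr => c _.
      by rewrite !mxE !nth_iota ?add1n // mxE.
    move=> c; rewrite mem_iota /= => cN; rewrite (_ : c = N - (N - c))%N; last by lia.
    by rewrite tail0 ?mulr0 //; lia.
  (* Multiplying by the adjugate gives q w = 0 without inverting A(C_m) over the integers. *)
  have := congr1 (mulmx (\adj A)) Aw0; rewrite mulmxA mul_adj_mx mul_scalar_mx mulmx0.
  move=> /matrixP w0 ltim; have := w0 (Ordinal ltim) 0; rewrite !mxE => /eqP.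
  by rewrite mulf_eq0 (negPf q_neq0) => /eqP.
move=> x; have [c] := label_edge x; rewrite mem_iota => cN ->.
have [lecm|ltmc] := leqP c m.
  by case: c cN lecm => // c _; apply: cyc0.
by rewrite (_ : c = N - (N - c))%N ?tail0 //; lia.
Qed.

(** * Division by the gcd and generation of the kernel *)

Lemma cpc_gcdE :
  cpc_gcd m n k D v e = \big[gcdn/0%N]_(x <- cpc_num m n k D v e) `|x|%N.
Proof.
rewrite /cpc_gcd /cpc_num !big_cat !big_map.
by congr (gcdn _ (gcdn _ _)); apply: eq_bigr => i _;
  rewrite !abszM absz_id abszX exp1n mul1n.
Qed.

Lemma cpc_gcd_dvd x : x \in cpc_num m n k D v e -> (cpc_gcd m n k D v e %| x)%Z.
Proof.
rewrite dvdzE absz_nat cpc_gcdE => x_in.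
by have := dvdnn (\big[gcdn/0%N]_(y <- cpc_num m n k D v e) `|y|%N);
  rewrite dvdn_biggcd => /allP; apply.
Qed.

Lemma size_cpc_num : size (cpc_num m n k D v e) = N.
Proof. by rewrite !size_cat !size_map !size_iota; lia. Qed.

Lemma cpc_gcd_neq0 : (cpc_gcd m n k D v e)%:Z != 0.
Proof.
apply: contraNneq c_last_neq0 => g0.
have := cpc_gcd_dvd (c_ N); rewrite g0 dvd0z; apply.
by rewrite mem_nth // size_cpc_num; lia.
Qed.

Definition cpc_at (x : 'I_ne) : int := (cpc m n k D v e)`_(edge_label x).-1.

Lemma edge_label_bound x : (0 < edge_label x <= N)%N.
Proof.
have [c cN ->] := label_edge x; rewrite edge_labelK //.
by move: cN; rewrite mem_iota; lia.
Qed.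

Lemma cpc_atE x : c_ (edge_label x) = (cpc_gcd m n k D v e)%:Z * cpc_at x.
Proof.
have lt_x : ((edge_label x).-1 < size (cpc_num m n k D v e))%N.
  by rewrite size_cpc_num; have := edge_label_bound x; lia.
by rewrite /cpc_at /cpc (nth_map 0) // mulrC divzK // cpc_gcd_dvd // mem_nth.
Qed.

Lemma cpc_at_kernel : in_kernel nv ne D cpc_at.
Proof.
move=> z; apply: (mulfI cpc_gcd_neq0); rewrite mulr0 -[RHS](cpc_in_kernel z) mulr_sumr.
by apply: eq_bigr => x _; rewrite cpc_atE mulrCA.
Qed.

Lemma cpc_at_last_neq0 : cpc_at (e N) != 0.
Proof.
have NN : N \in iota 1 N by rewrite mem_iota; lia.
apply: contraNneq c_last_neq0 => b0.
by have := cpc_atE (e N); rewrite edge_labelK // b0 mulr0 => ->.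
Qed.

Lemma cpc_at_span (u : 'I_ne -> int) :
  in_kernel nv ne D u -> exists t : int, forall x, u x = t * cpc_at x.
Proof.
move=> ku; pose c x := c_ (edge_label x); set g := cpc_gcd m n k D v e.
have cN : c (e N) != 0.
  by rewrite /c edge_labelK ?c_last_neq0 // mem_iota; lia.
(* The difference of the two sides is a kernel vector vanishing on e_N. *)
have prop x : c (e N) * u x = u (e N) * c x.
  apply/eqP; rewrite -subr_eq0; apply/eqP; move: x.
  apply: kernel_last_eq0; last by rewrite mulrC subrr.
  move=> z; under eq_bigr do rewrite mulrBr mulrCA [X in _ - X]mulrCA.
  by rewrite sumrB -!mulr_sumr ku (cpc_in_kernel z) !mulr0 subrr.
(* By proportionality c_N divides u_N times every entry of c, hence u_N times their gcd; the
   quotient is the multiplier t. *)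
have : (c (e N) %| u (e N) * g%:Z)%Z.
  rewrite dvdzE abszM absz_nat /g cpc_gcdE muln_biggcdr dvdn_biggcd.
  apply/allP => y /(nthP 0) [i]; rewrite size_cpc_num => lti <-.
  have iN : i.+1 \in iota 1 N by rewrite mem_iota; lia.
  rewrite -abszM -dvdzE; apply/dvdzP; exists (u (e i.+1)).
  by rewrite -[RHS]mulrC prop /c edge_labelK.
case/dvdzP => t tE; exists t => x; apply: (mulfI cN); apply: (mulfI cpc_gcd_neq0).
rewrite prop /c cpc_atE -/c -/g.
by rewrite -[LHS]mulrCA mulrA tE; ring.
Qed.

(** Each edge occurs exactly once among the labelled ones, so products over labels become products
    over all edges. *)
Lemma edge_binomialE (K : fieldType) :
  edge_binomial K [seq e i | i <- iota 1 N] (cpc m n k D v e) =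
  'X_[pos_exponent ne cpc_at] - 'X_[neg_exponent ne cpc_at].
Proof.
have zipE : zip [seq e i | i <- iota 1 N] (cpc m n k D v e) =
    [seq (x, cpc_at x) | x <- [seq e i | i <- iota 1 N]].
  rewrite -[RHS]zip_map map_id; congr zip.
  apply: (@eq_from_nth _ 0); rewrite !size_map ?size_cpc_num ?size_iota // => i lti.
  rewrite (nth_map (e 0%N)) ?size_map ?size_iota // (nth_map 0%N) ?size_iota //.
  by rewrite nth_iota // /cpc_at edge_labelK // mem_iota; lia.
have prodE (P : pred int) :
    \prod_(t <- zip [seq e i | i <- iota 1 N] (cpc m n k D v e) | P t.2)
      'X_(t.1) ^+ `|t.2|%N =
    'X_[[multinom (if P (cpc_at x) then `|cpc_at x|%N else 0%N) | x < ne]]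
      :> {mpoly K[ne]}.
  rewrite zipE big_map (perm_big _ e_perm) big_enum_cond mpolyXE_id big_mkcond /=.
  by apply: eq_bigr => x _; rewrite mnmE; case: ifP.
by rewrite /edge_binomial (prodE (fun y => 0 < y)) (prodE (fun y => y < 0)).
Qed.

End TwoCycles.

Theorem theorem4p13 (K : fieldType) (nv ne : nat) (D : wograph nv ne)
    (m n k : nat) (v : nat -> 'I_nv) (e : nat -> 'I_ne) :
  (1 <= k)%N -> (k < m)%N -> (k < n)%N ->
  perm_eq [seq v i | i <- iota 1 (m + n - k - 1)] (enum 'I_nv) ->
  perm_eq [seq e i | i <- iota 1 (m + n - k)] (enum 'I_ne) ->
  is_cycle D [seq v i | i <- rCm m] [seq e i | i <- cCm m] ->
  is_cycle D [seq v i | i <- rCn m n k] [seq e i | i <- cCn m n k] ->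
  ~~ balanced D v e m (rCm m) (cCm m) ->
  ~~ balanced D v e n (rCn m n k) (cCn m n k) ->
  ~~ balanced D v e (m + n - k.*2) (rC m n k) (cC m n k) ->
  let f : {mpoly K[ne]} :=
    edge_binomial K [seq e i | i <- iota 1 (m + n - k)] (cpc m n k D v e) in
  [/\ all (fun x => (cpc_gcd m n k D v e %| x)%Z) (cpc_num m n k D v e),
      primitive D f & generates f (toric_ideal D K)].
Proof.
move=> k_gt0 lt_km lt_kn v_perm e_perm cycle_m cycle_n unbal_m _ _.
have b_kernel := cpc_at_kernel _ _ _ _ _ _ _ _ k_gt0 lt_km lt_kn v_perm e_perm
  cycle_m cycle_n unbal_m.
have b_neq0 : exists x, cpc_at _ ne D m n k v e x != 0.
  by exists (e (m + n - k)%N); apply: cpc_at_last_neq0.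
have b_span := cpc_at_span _ _ _ _ _ _ _ _ k_gt0 lt_km lt_kn v_perm e_perm
  cycle_m cycle_n unbal_m.
rewrite /= edge_binomialE //; split.
- by apply/allP => x; apply: cpc_gcd_dvd.
- exact: binomial_primitive.
- exact: binomial_generates.
Qed.
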